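(* There exist absolute constants $\alpha, \beta, \gamma, C > 0$ such that the following holds. For all integers $n \ge 1$, $p \ge 1$, and all $\varepsilon, \delta$ with $p^{-1/3} \le \varepsilon \le 1/2$ and $\alpha e^{-\beta \varepsilon^2 p} \le \delta < 1$, there is a (randomized) emptier algorithm for the renormalized multi-processor cup game on $n$ cups with parameters $p, \varepsilon, \delta$ such that for every oblivious filler and every step $i$, the probability that the backlog after step $i$ exceeds $3$ is at most $C e^{-\gamma \varepsilon^2 p}$.
   Context: Renormalized multi-processor cup game with parameters $p,\varepsilon,\delta$: $n$ cups, initially empty. In each step the filler pours nonnegative amounts $c_j(i)$ into the cups with $c_j(i) \le 1$ for every cup $j$ and $\sum_j c_j(i) \le (1-\varepsilon)p$; then the emptier selects up to $p+1$ distinct cups and removes up to $1+2\delta$ units of water from each. The filler is oblivious: all pouring amounts are fixed in advance, independently of the emptier's randomness. The backlog after a step is the maximum amount of water in any cup. *)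

(* Defs.v *)
From HB Require Import structures.
From mathcomp Require Import all_boot all_order all_algebra.
From mathcomp Require Import all_classical all_reals all_analysis.

Set Implicit Arguments.
Unset Strict Implicit.
Unset Printing Implicit Defensive.

Import Order.TTheory GRing.Theory Num.Theory.
Local Open Scope ring_scope.

(* Steps are numbered from 0, and [c i j] is the amount poured into cup [j] in
   step [i]. An oblivious filler is a fixed sequence of pours. *)
Definition filler (R : realType) (n : nat) := nat -> 'I_n -> R.

Definition legal_filler (R : realType) (n p : nat) (eps : R)
    (c : filler R n) : Prop :=
  forall i : nat,
    (forall j : 'I_n, 0 <= c i j <= 1) /\
    \sum_(j < n) c i j <= (1 - eps) * p%:R.

(* [e w h j] is the amount removed from cup [j] when the random outcome is [w]
   and [h] lists the pours of all steps so far, the current one included. The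
   emptier is online because it only receives this list. Its own past actions
   and the current amounts of water are functions of [w] and [h], so they need
   not be arguments. *)
Definition emptier (R : realType) (n : nat) (T : Type) :=
  T -> seq ('I_n -> R) -> 'I_n -> R.

(* Amount of water in cup [j] after the first [t] steps (steps 0 to t - 1). *)
Fixpoint water (R : realType) (n : nat) (T : Type) (e : emptier R n T)
    (c : filler R n) (w : T) (t : nat) (j : 'I_n) : R :=
  if t is i.+1 then water e c w i j + c i j - e w (mkseq c i.+1) j else 0.

(* The default value 0 of the maximum is harmless, as legal emptiers never
   remove more water than is present. *)
Definition backlog (R : realType) (n : nat) (T : Type) (e : emptier R n T)
    (c : filler R n) (w : T) (t : nat) : R :=
  \big[Num.max/0]_(j < n) water e c w t j.

(* The measurability clause says that the removals are random variables, so
   that the backlog against a fixed filler is one too. *)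
Definition legal_emptier (R : realType) (n p : nat) (eps delta : R)
    (d : measure_display) (T : measurableType d) (e : emptier R n T) : Prop :=
  forall c : filler R n, legal_filler p eps c -> forall i : nat,
    (forall w : T, exists S : {set 'I_n},
       [/\ (#|S| <= p.+1)%N,
           forall j, j \notin S -> e w (mkseq c i.+1) j = 0 &
           forall j, j \in S ->
             [/\ 0 <= e w (mkseq c i.+1) j,
                 e w (mkseq c i.+1) j <= 1 + 2 * delta &
                 e w (mkseq c i.+1) j <= water e c w i j + c i j]]) /\
    (forall j : 'I_n,
       measurable_fun [set: T] (fun w : T => e w (mkseq c i.+1) j)).

(* Main.v *)
Require Import Defs.
From HB Require Import structures.
From mathcomp Require Import all_boot all_order all_algebra.
From mathcomp Require Import all_classical all_reals all_analysis.
From mathcomp Require Import measurable_realfun lra ring zify.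

Set Implicit Arguments.
Unset Strict Implicit.
Unset Printing Implicit Defensive.

Import Order.TTheory GRing.Theory Num.Theory.
Local Open Scope classical_set_scope.
Local Open Scope ring_scope.

(** Fix z = 1 + delta/2.  Cutting the water poured into a cup into blocks of
    size z, the emptier issues one service request per block, at a random moment
    chosen by ordered pivotal sampling: a cup issues at most one request per
    step, a pour of size a triggers a request with probability exactly a/z, and
    the requests of a cup at different steps are negatively dependent, in the
    sense that E prod_s l_s^(request_s) <= prod_s (1 + (l_s - 1) y_s) for all
    l_s >= 1, where y_s is the pour at step s divided by z.  Randomness is
    refreshed in every block, so no bad random choice lasts forever.

    Requests wait in a queue and each step serves up to p + 1 cups with pending
    requests.  A step with X requests lengthens the queue by at most (X - p)^+,
    and as z > 1 the queue shrinks by one in every k = O(1/delta) steps, up to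
    these excesses.  Hence a nonempty queue forces, for some r >= 1, a total
    excess of at least r during the last r k steps.  With x = eps/2, the product
    of the factors 1 + (1 + x)^(X - p) over these steps is then at least
    (1 + x)^r, while its expectation is at most (1 + zeta)^(r k) with
    zeta <= exp(- eps^2 p / 4).  Summing Markov's inequality over r bounds the
    probability of a nonempty queue by O(k zeta / eps^2), and when the queue is
    empty every cup holds at most 2 z <= 3 units. *)

(** * Sampling coins of varying bias from one uniform variable *)

Definition uniform01 (R : realType) :=
  mrestr (@lebesgue_measure R) (measurable_itv `[0, 1[%R).

HB.instance Definition _ (R : realType) := Measure.on (@uniform01 R).

Lemma uniform01_setT (R : realType) : @uniform01 R [set: R] = 1%:E.
Proof.
rewrite /uniform01 /mrestr setTI lebesgue_measure_itv /= lte_fin ltr01.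
by rewrite oppr0 adde0.
Qed.

HB.instance Definition _ (R : realType) :=
  @Measure_isProbability.Build _ _ R (@uniform01 R) (@uniform01_setT R).

Lemma uniform01_le_length (R : realType) (D : set R) (a l : R) :
  0 <= l -> measurable D ->
  (forall w, D w -> 0 <= w < 1 -> a <= w <= a + l) ->
  (@uniform01 R D <= l%:E)%E.
Proof.
move=> l0 mD Dal.
apply: (@le_trans _ _ (lebesgue_measure `[a, (a + l)]%classic)).
  apply: le_measure; rewrite ?inE /=.
  - by apply: measurableI => //; exact: measurable_itv.
  - exact: measurable_itv.
  - by move=> w [Dw]; rewrite /= !in_itv /=; exact: Dal.
rewrite lebesgue_measure_itv /= lte_fin; case: ifP => _ //.
by rewrite -EFinD addrAC subrr add0r.
Qed.

Lemma measure_bigsetU_le (d : measure_display) (T : measurableType d)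
    (R : realType) (m : {measure set T -> \bar R}) (I : Type) (r : seq I)
    (F : I -> set T) : (forall i, measurable (F i)) ->
  (m (\big[setU/set0]_(i <- r) F i) <= \sum_(i <- r) m (F i))%E.
Proof.
move=> mF; elim: r => [|i r IH]; first by rewrite !big_nil measure0.
rewrite !big_cons; apply: le_trans (leeD2l _ IH).
by apply: measureU2 => //; exact: bigsetU_measurable.
Qed.

Section Coding.
Variables (R : realType) (O : finType) (o0 : O).
Implicit Types (m : O -> R) (l : seq O) (u v w : R).

(** Inverse-CDF sampling: intervals of lengths [m o] are laid end to end; the result is the one
    containing [u] and the relative position of [u] in it. The default [o0] appears only when [u]
    lies beyond the total mass. *)
Fixpoint choose m l u : O * R :=
  if l is o :: l' then
    if u < m o then (o, u / m o) else choose m l' (u - m o)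
  else (o0, u).

Fixpoint mass_before m l o : R :=
  if l is x :: l' then if x == o then 0 else m x + mass_before m l' o else 0.

Lemma chooseP m l u : (forall o, 0 <= m o) -> uniq l ->
  0 <= u < \sum_(o <- l) m o ->
  [/\ (choose m l u).1 \in l, 0 <= (choose m l u).2 < 1 &
      u = mass_before m l (choose m l u).1
          + m (choose m l u).1 * (choose m l u).2].
Proof.
move=> m0; elim: l u => [|x l IH] u /=.
  by rewrite big_nil => _ /andP[u0 /(le_lt_trans u0)]; rewrite ltxx.
rewrite big_cons => /andP[xl ul] /andP[u0 us].
case: ifPn => [ux|]; last rewrite -leNgt => xu.
  have mx : 0 < m x by exact: le_lt_trans ux.
  rewrite /= mem_head eqxx divr_ge0 ?(ltW mx)//= ltr_pdivrMr// mul1r ux.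
  by rewrite add0r mulrC divfK// gt_eqF.
have [|ol v01 uE] := IH (u - m x) ul.
  by rewrite subr_ge0 xu ltrBlDl.
rewrite inE ol orbT v01; split=> //.
have /negbTE -> : x != (choose m l (u - m x)).1.
  by apply: contraNneq xl => ->.
by rewrite -addrA -uE addrC subrK.
Qed.

Lemma measurable_choose m l :
  measurable_fun [set: R] (fun u => (choose m l u).2) /\
  forall o, measurable_fun [set: R] (fun u => (choose m l u).1 == o).
Proof.
elim: l => [|x l [IH1 IH2]] /=.
  by split=> [|o]; [exact: measurable_id | exact: measurable_cst].
have mlt : measurable_fun [set: R] (fun u : R => u < m x).
  by apply: measurable_fun_ltr; [exact: measurable_id | exact: measurable_cst].
have mB : measurable_fun [set: R] (fun u : R => u - m x).
  by apply: measurable_funB; [exact: measurable_id | exact: measurable_cst].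
split=> [|o].
- rewrite (_ : (fun _ => _) = fun u => if u < m x then u / m x
      else (choose m l (u - m x)).2); last first.
    by apply/funext => u; case: ifP.
  apply: measurable_fun_ifT => //.
    by apply: measurable_funM; [exact: measurable_id | exact: measurable_cst].
  exact: (measurableT_comp IH1 mB).
- rewrite (_ : (fun _ => _) = fun u => if u < m x then x == o
      else (choose m l (u - m x)).1 == o); last first.
    by apply/funext => u; case: ifP.
  apply: measurable_fun_ifT => //.
  exact: (measurableT_comp (IH2 o) mB).
Qed.

Variable mu : nat -> O -> R.

(* Arithmetic coding: conditionally on the first [s] coins, [residual w s] is
   again uniform on [0, 1[. The [s]-th coin only depends on [mu 0], ..., [mu s],
   so a single [w] serves all fillers online. *)
Fixpoint residual w (s : nat) : R :=
  if s is s'.+1 then (choose (mu s') (enum O) (residual w s')).2 else w.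

Definition coins w (s : nat) : O :=
  (choose (mu s) (enum O) (residual w s)).1.

Lemma nth_outcome x0 t w i : (i < t)%N ->
  nth x0 [seq coins w k | k <- iota 0 t] i = coins w i.
Proof. by move=> it; rewrite (nth_map 0%N) ?size_iota // nth_iota. Qed.

Lemma measurable_residual s : measurable_fun [set: R] (residual^~ s).
Proof.
elim: s => [|s IH] /=; first exact: measurable_id.
exact: (measurableT_comp (measurable_choose _ _).1 IH).
Qed.

Lemma measurable_coins s o : measurable [set w | coins w s = o].
Proof.
have := measurableT_comp ((measurable_choose (mu s) (enum O)).2 o)
  (measurable_residual s).
move=> /(_ measurableT [set true] I); rewrite setTI.
by congr (measurable _); apply/seteqP; split=> w /= /eqP.
Qed.

Definition outcome s r w : seq O := [seq coins w k | k <- iota s r].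

(** Sequences over a finite alphabet are countable, so any event on them is a countable union of
    cylinders; hence [B] can be arbitrary. *)
Lemma measurable_outcome s r (B : set (seq O)) :
  measurable [set w | B (outcome s r w)].
Proof.
rewrite (_ : [set _ | _] =
    \bigcup_h [set w | outcome s r w = h /\ B h]); last first.
  by apply/seteqP; split=> [w Bw|w [h _ [<-]]//]; exists (outcome s r w).
apply: countable_bigcupT_measurable => [|h].
  exact: countableP.
have [Bh|nB] := pselect (B h); last first.
  rewrite (_ : [set _ | _] = set0) //.
  by apply/seteqP; split=> w //= -[_ /nB].
rewrite (_ : [set _ | _] = [set w | outcome s r w = h]); last first.
  by apply/seteqP; split=> w //= -[].
elim: r s h {Bh} => [|r IH] s h; rewrite /outcome /=.
  by case: h => [|o h]; [rewrite (_ : [set _ | _] = setT) //; apply/seteqP |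
    rewrite (_ : [set _ | _] = set0) //; apply/seteqP; split].
case: h => [|o h].
  by rewrite (_ : [set _ | _] = set0) //; apply/seteqP; split.
rewrite (_ : [set _ | _] =
    [set w | coins w s = o] `&` [set w | outcome s.+1 r w = h]).
  by apply: measurableI; [exact: measurable_coins | exact: IH].
by apply/seteqP; split=> w /=; rewrite /outcome => -[<- <-].
Qed.

(** Expectation over [r] independent coins with laws [mu s], [mu s.+1], ..., as a finite sum, so
    that the estimates need no integrals. *)
Fixpoint expect s r (F : seq O -> R) : R :=
  if r is r'.+1 then \sum_o mu s o * expect s.+1 r' (fun h => F (o :: h))
  else F [::].

Hypothesis mu0 : forall s o, 0 <= mu s o.
Hypothesis mu1 : forall s, \sum_o mu s o = 1.

Lemma le_expect s r F G : (forall h, size h = r -> F h <= G h) ->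
  expect s r F <= expect s r G.
Proof.
elim: r s F G => [|r IH] s F G FG /=; first exact: FG.
apply: ler_sum => o _; apply: ler_wpM2l => //.
by apply: IH => h hr; apply: FG; rewrite /= hr.
Qed.

Lemma expect_cst s r a : expect s r (fun _ => a) = a.
Proof.
elim: r s => [|r IH] s //=.
by under eq_bigr do rewrite IH; rewrite -mulr_suml mu1 mul1r.
Qed.

Lemma expectZ s r a F : expect s r (fun h => a * F h) = a * expect s r F.
Proof.
elim: r s F => [|r IH] s F //=; rewrite mulr_sumr.
by apply: eq_bigr => o _; rewrite IH mulrCA.
Qed.

Lemma expect_sum s r (I : Type) (l : seq I) (P : pred I) (F : I -> seq O -> R) :
  expect s r (fun h => \sum_(i <- l | P i) F i h) =
  \sum_(i <- l | P i) expect s r (F i).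
Proof.
elim: r s F => [|r IH] s F //=; rewrite exchange_big /=.
by apply: eq_bigr => o _; rewrite IH mulr_sumr.
Qed.

Lemma expectD s r F G :
  expect s r (fun h => F h + G h) = expect s r F + expect s r G.
Proof.
elim: r s F G => [|r IH] s F G //=; rewrite -big_split /=.
by apply: eq_bigr => o _; rewrite IH mulrDr.
Qed.

Local Notation P := (@uniform01 R).

(** [D] stands for a prefix of coins already seen and [l] for its probability: on [D] the seed is
    affine in the residual with slope [l]. Seeing a further coin [o] multiplies the slope by
    [mu s o]. *)
Lemma uniform01_outcome_le_in s r (B : set (seq O)) (D : set R) (a l : R) :
  0 <= l -> measurable D ->
  (forall w, D w -> 0 <= w < 1 ->
     0 <= residual w s < 1 /\ w = a + l * residual w s) ->
  (P (D `&` [set w | B (outcome s r w)])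
   <= (l * expect s r (fun h => (`[< B h >])%:R))%:E)%E.
Proof.
elim: r s B D a l => [|r IH] s B D a l l0 mD Dw /=.
  have [B0|nB] := asboolP (B [::]); last first.
    rewrite mulr0 (_ : D `&` _ = set0) ?measure0 //.
    by apply/seteqP; split=> w //= -[_ /nB].
  rewrite mulr1; apply: (uniform01_le_length (a := a)) => //.
    by apply: measurableI => //; exact: measurable_outcome.
  move=> w [] /Dw{}Dw _ /Dw [/andP[u0 u1] ->].
  by rewrite lerDl lerD2l mulr_ge0 //= ler_piMr // ltW.
pose Do o := (D `&` [set w | coins w s = o]) `&`
  [set w | B (o :: outcome s.+1 r w)].
have mDo o : measurable (Do o).
  apply: measurableI.
    by apply: measurableI => //; exact: measurable_coins.
  exact: (measurable_outcome s.+1 r (fun h => B (o :: h))).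
have -> : D `&` [set w | B (outcome s r.+1 w)] = \big[setU/set0]_o Do o.
  rewrite -bigcup_seq; apply/seteqP; split=> [w [wD wB]|w [x _ [[wD wx] wB]]].
    by exists (coins w s) => //=; rewrite mem_index_enum.
  by split=> //; rewrite /= /outcome /= wx.
apply: (@le_trans _ _ (\sum_o P (Do o))%E).
  exact: measure_bigsetU_le.
rewrite mulr_sumr -sumEFin; apply: lee_sum => o _.
rewrite mulrA; apply: (IH s.+1 (fun h => B (o :: h)) _
  (a + l * mass_before (mu s) (enum O) o)).
- by rewrite mulr_ge0.
- by apply: measurableI => //; exact: measurable_coins.
move=> w [/Dw{}Dw /= <-] /Dw [u01 wE].
have := @chooseP (mu s) (enum O) (residual w s) (mu0 s) (enum_uniq _).
rewrite big_enum /= mu1 => /(_ u01) [_ -> uE]; split=> //.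
by rewrite {1}wE {1}uE mulrDr addrA mulrA.
Qed.

Lemma uniform01_outcome_le t (B : set (seq O)) :
  (P [set w | B (outcome 0 t w)]
   <= (expect 0 t (fun h => (`[< B h >])%:R))%:E)%E.
Proof.
have := @uniform01_outcome_le_in 0 t B setT 0 1 ler01 measurableT.
by rewrite setTI mul1r; apply=> w _ w01; rewrite /= mul1r add0r.
Qed.

End Coding.

Lemma eq_coins (R : realType) (O : finType) (o0 : O) (mu mu' : nat -> O -> R)
    (w : R) (s : nat) : (forall i, (i <= s)%N -> mu i = mu' i) ->
  coins o0 mu w s = coins o0 mu' w s.
Proof.
move=> E; rewrite /coins E //; congr (choose _ _ _ _).1.
elim: s E => //= s IH E.
by rewrite IH ?E // => i /leqW /E.
Qed.

(** * Ordered pivotal sampling in one cup *)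

Section SingleCup.
Variables (R : realType) (y : nat -> R).

(* [pos s] is the position inside the current block, in units of the block size.
   The block's request is still to come with probability [1 - pos s]. *)
Fixpoint pos (s : nat) : R :=
  if s is s'.+1 then
    let v := pos s' + y s' in if 1 <= v then v - 1 else v
  else 0.

Definition cross (s : nat) : bool := 1 <= pos s + y s.

(* If the block has issued no request yet, one comes now with probability
   [y / (1 - pos)]. When the pour enters the next block, up to position [pos'],
   a missing request must be issued at once; if it was already issued, the
   request of the next block comes now with probability [pos' / pos]. In total a
   request is issued with probability [(1 - pos) + pos' = y], and the flag of the
   new block is set with probability [pos']. *)
Definition coin_prob (s : nat) : R :=
  if cross s then (pos s + y s - 1) / pos s else y s / (1 - pos s).

(** [x] marks a pour that enters the next block, [F] a block whose request is already issued, [a]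
    the coin. If a crossing forces the old block's request, the coin is ignored and the new block
    starts unfired, so a step never issues two requests. *)
Definition fire (x F a : bool) : bool := if x then ~~ F || a else ~~ F && a.

Definition next_fired (x F a : bool) : bool := if x then F && a else F || a.

Lemma pos_next s : pos s.+1 = pos s + y s - (cross s)%:R.
Proof. by rewrite /= /cross; case: ifP; rewrite ?subr0. Qed.

(** A conservation law: [pos - F] is exactly the amount poured, in blocks, minus the number of
    requests issued, so the two counts never drift apart. *)
Lemma fire_balance s F a :
  (fire (cross s) F a)%:R + pos s.+1 + F%:R =
  y s + pos s + (next_fired (cross s) F a)%:R :> R.
Proof.
rewrite pos_next /fire /next_fired.
by case: (cross s); case: F; case: a => /=; ring.
Qed.

Hypothesis y01 : forall s, 0 <= y s < 1.

Lemma pos_itv s : 0 <= pos s < 1.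
Proof.
elim: s => [|s] /=; first by rewrite lexx ltr01.
by have := y01 s; case: ifPn => ?; lra.
Qed.

Lemma coin_prob_itv s : 0 <= coin_prob s <= 1.
Proof.
have /andP[p0 p1] := pos_itv s; have /andP[y0 y1] := y01 s.
rewrite /coin_prob /cross; case: ifPn => [c1|]; last rewrite -ltNge => c1.
  have p_gt0 : 0 < pos s by lra.
  by rewrite ler_pdivrMr // mul1r divr_ge0 ?(ltW p_gt0) ?subr_ge0 //=; lra.
have q_gt0 : 0 < 1 - pos s by lra.
by rewrite ler_pdivrMr // mul1r divr_ge0 ?(ltW q_gt0) //=; lra.
Qed.

Variable l : nat -> R.
Hypothesis l1 : forall s, 1 <= l s.

Fixpoint mgf (r s : nat) (F : bool) : R :=
  if r is r'.+1 then
    \sum_(a : bool) (if a then coin_prob s else 1 - coin_prob s) *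
      l s ^+ fire (cross s) F a * mgf r' s.+1 (next_fired (cross s) F a)
  else 1.

(** Run both flags with the same coin: the unfired one pays an extra factor [l s >= 1] and the next
    flags agree, or the factors agree and the next flags stay ordered. This monotonicity is the
    source of negative dependence. *)
Lemma mgf_fired_le r s : 0 <= mgf r s true <= mgf r s false.
Proof.
elim: r s => [|r IH] s /=; first by rewrite ler01 lexx.
have /andP[t0 tf] := IH s.+1; have /andP[q0 q1] := coin_prob_itv s.
have ls := l1 s; rewrite !big_bool /fire /next_fired.
set q := coin_prob s in q0 q1 *; set M1 := mgf r s.+1 true in t0 tf *.
set M0 := mgf r s.+1 false in tf *.
case: (cross s) => /=; rewrite -/M1 -/M0 ?expr1 ?expr0 ?mulr1.
- have h1 : 0 <= q * l s * M1 by rewrite !mulr_ge0 //; lra.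
  have h2 : q * l s * M1 <= q * l s * M0.
    by rewrite ler_wpM2l // mulr_ge0 //; lra.
  have h3 : 0 <= (1 - q) * M0 by rewrite mulr_ge0 //; lra.
  have h4 : (1 - q) * M0 <= (1 - q) * l s * M0.
    by rewrite -mulrA ler_wpM2l ?subr_ge0 // ler_peMl //; lra.
  by lra.
- have h1 : M1 <= l s * M1 by rewrite ler_peMl.
  have h2 : q * M1 <= q * l s * M1 by rewrite -mulrA ler_wpM2l.
  have h3 : (1 - q) * M1 <= (1 - q) * M0 by rewrite ler_wpM2l // subr_ge0.
  have h4 : 0 <= q * M1 by rewrite mulr_ge0.
  have h5 : 0 <= (1 - q) * M1 by rewrite mulr_ge0 // subr_ge0.
  by lra.
Qed.

(* The left-hand side averages over the law of the flag at time [s]. *)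
Lemma mgf_mean_le r s :
  (1 - pos s) * mgf r s false + pos s * mgf r s true <=
  \prod_(s <= i < s + r) (1 + (l i - 1) * y i).
Proof.
elim: r s => [|r IH] s; first by rewrite addn0 big_geq //= !mulr1 subrK.
rewrite big_ltn ?addnS ?ltnS ?leq_addr // -addSn.
have /andP[p0 p1] := pos_itv s; have /andP[y0 y1] := y01 s.
have /andP[p0' p1'] := pos_itv s.+1.
have ls := l1 s; have /andP[t0 tf] := mgf_fired_le r s.+1.
have V0 : 0 <= 1 + (l s - 1) * y s by rewrite addr_ge0 // mulr_ge0 // subr_ge0.
apply: le_trans (ler_wpM2l V0 (IH s.+1)).
rewrite [mgf r.+1 s false]/= [mgf r.+1 s true]/= !big_bool /fire /next_fired.
move: t0 tf p0' p1'; rewrite pos_next /coin_prob /cross.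
set M1 := mgf r s.+1 true; set M0 := mgf r s.+1 false.
have ly : 0 <= (l s - 1) * y s by rewrite mulr_ge0 // subr_ge0.
case: ifPn => [c1|]; last rewrite -ltNge => c1; move=> t0 tf p0' p1' /=;
  rewrite -/M1 -/M0 ?expr1 ?expr0 ?mulr1.
- have pn0 : pos s != 0 by lra.
  set p' := pos s + y s - 1 in p0' p1' *.
  rewrite (_ : _ + pos s * _ = (1 - pos s) * l s * M0 +
      (p' * l s * M1 + (pos s - p') * M0)); last by rewrite /p'; field.
  (* This product is exactly the slack of the induction step; it is nonnegative because [M1 <= M0].
     The case without crossing has a similar slack. *)
  have h1 : 0 <= (l s - 1) * (M0 - M1) * p' * (1 - y s).
    by rewrite !mulr_ge0 // ?subr_ge0 // ltW.
  rewrite -subr_ge0.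
  have -> : (1 + (l s - 1) * y s) * ((1 - p') * M0 + p' * M1) -
      ((1 - pos s) * l s * M0 + (p' * l s * M1 + (pos s - p') * M0)) =
      (l s - 1) * (M0 - M1) * p' * (1 - y s) by rewrite /p'; ring.
  exact: h1.
- have pn1 : 1 - pos s != 0 by lra.
  rewrite (_ : _ + pos s * _ = y s * l s * M1 + (1 - pos s - y s) * M0 +
      pos s * M1); last by field.
  rewrite -subr_ge0.
  have -> : (1 + (l s - 1) * y s) * ((1 - (pos s + y s - 0)) * M0 +
      (pos s + y s - 0) * M1) - (y s * l s * M1 + (1 - pos s - y s) * M0 +
      pos s * M1) = (l s - 1) * y s * (1 - (pos s + y s)) * (M0 - M1) by ring.
  by rewrite !mulr_ge0 // ?subr_ge0 // ltW.
Qed.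

End SingleCup.

(** * Exponential moments of the number of requests *)

Section Joint.
Variables (R : realType) (n : nat) (y : nat -> 'I_n -> R).
Local Notation O := {ffun 'I_n -> bool}.
Implicit Types (om : nat -> O) (s : nat) (j : 'I_n).

Definition coin_mass s (o : O) : R :=
  \prod_j (if o j then coin_prob (y^~ j) s else 1 - coin_prob (y^~ j) s).

Fixpoint fired om s : 'I_n -> bool :=
  if s is s'.+1 then
    fun j => next_fired (cross (y^~ j) s') (fired om s' j) (om s' j)
  else fun _ => false.

Definition fires om s j : bool :=
  fire (cross (y^~ j) s) (fired om s j) (om s j).

Definition load om s : nat := (\sum_j fires om s j)%N.

Hypothesis y01 : forall s j, 0 <= y s j < 1.

Lemma coin_mass_ge0 s o : 0 <= coin_mass s o.
Proof.
apply: prodr_ge0 => j _.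
have /andP[? ?] := @coin_prob_itv _ (y^~ j) (y01^~ j) s.
by case: ifP; rewrite ?subr_ge0.
Qed.

Lemma coin_mass_sum s : \sum_o coin_mass s o = 1.
Proof.
rewrite -(bigA_distr_bigA (fun j (b : bool) =>
  if b then coin_prob (y^~ j) s else 1 - coin_prob (y^~ j) s)).
by rewrite big1 // => j _; rewrite big_bool /= addrC subrK.
Qed.

Fixpoint weight (l : nat -> R) s (F : 'I_n -> bool) (h : seq O) : R :=
  if h is o :: h' then
    (\prod_j l s ^+ fire (cross (y^~ j) s) (F j) (o j)) *
    weight l s.+1 (fun j => next_fired (cross (y^~ j) s) (F j) (o j)) h'
  else 1.

(** Cups have independent coins and separate flags, so the expectation factors over cups. *)
Lemma expect_weight l s r F :
  expect coin_mass s r (weight l s F) = \prod_j mgf (y^~ j) l r s (F j).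
Proof.
elim: r s F => [|r IH] s F /=; first by rewrite big1.
rewrite bigA_distr_bigA; apply: eq_bigr => o _.
rewrite expectZ IH /coin_mass -!big_split; apply: eq_bigr => j _ /=.
by rewrite mulrA.
Qed.

Lemma weightE l om s r :
  weight l s (fired om s) [seq om i | i <- iota s r] =
  \prod_(s <= i < s + r) l i ^+ load om i.
Proof.
elim: r s => [|r IH] s; first by rewrite addn0 big_geq.
rewrite big_ltn ?addnS ?ltnS ?leq_addr // -addSn -IH /=.
by congr (_ * _); rewrite /load -prodrXr.
Qed.

(** The default is harmless: only coins inside [h] are read in what follows. *)
Definition path_of (h : seq O) : nat -> O := nth [ffun=> false] h.

Lemma expect_load_le l t : (forall s, 1 <= l s) ->
  expect coin_mass 0 t (fun h => \prod_(i < t) l i ^+ load (path_of h) i) <=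
  \prod_(i < t) \prod_j (1 + (l i - 1) * y i j).
Proof.
move=> l1.
apply: (@le_trans _ _ (expect coin_mass 0 t (weight l 0 (fun=> false)))).
  apply: le_expect; first exact: coin_mass_ge0.
  move=> h <-; rewrite -(big_mkord xpredT (fun i => l i ^+ load (path_of h) i)).
  rewrite -(@weightE l (path_of h) 0 (size h)) /= -/(mkseq _ _).
  by rewrite mkseq_nth.
rewrite expect_weight exchange_big /=; apply: ler_prod => j _.
have yj : forall s, 0 <= y s j < 1 by move=> s; exact: y01.
have /andP[t0 tf] := mgf_fired_le yj l1 t 0.
rewrite (le_trans t0 tf) /=.
have := mgf_mean_le yj l1 t 0.
by rewrite /= subr0 mul1r mul0r addr0 big_mkord.
Qed.

Variables (m x : R).
Hypothesis x0 : 0 <= x.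
Hypothesis ym : forall s, \sum_j y s j <= m.

Lemma expect_affine_load_le (a b : nat -> R) t :
  (forall i, 0 <= a i) -> (forall i, 0 <= b i) ->
  expect coin_mass 0 t
    (fun h => \prod_(i < t) (a i + b i * (1 + x) ^+ load (path_of h) i)) <=
  \prod_(i < t) (a i + b i * expR (x * m)).
Proof.
move=> a0 b0.
have split_prod (g : nat -> R) : \prod_(i < t) (a i + b i * g i) =
    \sum_(f : {ffun 'I_t -> bool}) (\prod_(i < t) (if f i then b i else a i)) *
      \prod_(i < t) (if f i then g i else 1).
  transitivity (\prod_(i < t) \sum_(e : bool)
      (if e then b i else a i) * (if e then g i else 1)).
    by apply: eq_bigr => i _; rewrite big_bool /= mulr1 addrC.
  by rewrite bigA_distr_bigA; apply: eq_bigr => f _; rewrite -big_split.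
(* Expanding the product leaves moment generating functions with weights [1] or
   [1 + x] at each step. *)
rewrite (split_prod (fun=> expR (x * m))).
rewrite (_ : (fun h => _) = fun h => \sum_(f : {ffun 'I_t -> bool})
    (\prod_(i < t) (if f i then b i else a i)) *
    \prod_(i < t) (if f i then (1 + x) ^+ load (path_of h) i else 1));
  last first.
  by apply/funext => h; exact: (split_prod (fun i => _ ^+ load (path_of h) i)).
rewrite expect_sum; apply: ler_sum => f _; rewrite expectZ.
apply: ler_wpM2l; first by apply: prodr_ge0 => i _; case: ifP.
(* The choice [f] is extended beyond [t] by the neutral weight 1. *)
pose l i : R := if oapp f false (insub i : option 'I_t) then 1 + x else 1.
have lE (i : 'I_t) : l i = if f i then 1 + x else 1 by rewrite /l valK.
have l1 i : 1 <= l i by rewrite /l; case: ifP; rewrite ?lerDl.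
rewrite (_ : (fun h => _) =
    fun h => \prod_(i < t) l i ^+ load (path_of h) i); last first.
  apply/funext => h; apply: eq_bigr => i _; rewrite lE.
  by case: (f i); rewrite ?expr1n.
apply: le_trans (expect_load_le t l1) _; apply: ler_prod => i _.
have pos_factor j : 0 <= 1 + (l i - 1) * y i j.
  by rewrite addr_ge0 // mulr_ge0 ?subr_ge0 //; case/andP: (y01 i j).
rewrite prodr_ge0 //=; rewrite lE; case: (f i); last first.
  by rewrite subrr big1 // => j _; rewrite mul0r addr0.
apply: (@le_trans _ _ (\prod_j expR (x * y i j))).
  apply: ler_prod => j _; have /andP[y0 _] := y01 i j.
  rewrite [1 + x]addrC addrK expR_ge1Dx andbT.
  by rewrite addr_ge0 // mulr_ge0.
by rewrite -expR_sum ler_expR -mulr_sumr ler_wpM2l.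
Qed.

End Joint.

(** * The queue of pending requests *)

Section Queue.
Variables (R : realType) (n p : nat) (z : R) (c : nat -> 'I_n -> R).
Local Notation O := {ffun 'I_n -> bool}.
Implicit Types (om : nat -> O) (s t : nat) (j : 'I_n).

Definition rate s j : R := c s j / z.

Definition served_of (d : 'I_n -> nat) : {set 'I_n} :=
  [set j in take p.+1 (enum [pred j | (0 < d j)%N])].

Fixpoint pend om s : 'I_n -> nat :=
  if s is s'.+1 then
    let d j := (pend om s' j + fires rate om s' j)%N in
    fun j => (d j - (j \in served_of d))%N
  else fun _ => 0%N.

Definition demand om s j : nat := (pend om s j + fires rate om s j)%N.

Definition served om s : {set 'I_n} := served_of (demand om s).

Fixpoint tank om s : 'I_n -> R :=
  if s is s'.+1 then fun j =>
    tank om s' j + c s' j -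
    (if j \in served om s' then Num.min z (tank om s' j + c s' j) else 0)
  else fun _ => 0.

Definition removal om s j : R :=
  if j \in served om s then Num.min z (tank om s j + c s j) else 0.

Definition queue om s : nat := (\sum_j pend om s j)%N.

Definition excess om s : nat := (load rate om s - p)%N.

Lemma served_ofE (d : 'I_n -> nat) j : j \in served_of d -> (0 < d j)%N.
Proof. by rewrite inE => /mem_take; rewrite mem_enum. Qed.

Lemma card_served_of (d : 'I_n -> nat) :
  #|served_of d| = minn p.+1 #|[pred j | (0 < d j)%N]|.
Proof.
rewrite cardsE -[RHS](_ : size (take p.+1 (enum [pred j | (0 < d j)%N])) = _).
  by apply/card_uniqP; exact: take_uniq (enum_uniq _).
by rewrite size_take_min -cardE.
Qed.

Lemma pendS om s j : (pend om s.+1 j + (j \in served om s) = demand om s j)%N.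
Proof.
rewrite /= -/(demand om s) -/(served om s).
rewrite subnK //; case: (boolP (j \in _)) => // /served_ofE; exact.
Qed.

Lemma queueS om s :
  (queue om s.+1 + #|served om s| = queue om s + load rate om s)%N.
Proof.
rewrite /queue /load -big_split /= -sum1_card [X in (_ + X)%N]big_mkcond.
rewrite -big_split; apply: eq_bigr => j _.
transitivity (pend om s.+1 j + (j \in served om s))%N; last exact: pendS.
by congr (_ + _)%N; case: (_ \in _).
Qed.

Lemma load_le_card om s :
  (load rate om s <= #|[pred j | (0 < demand om s j)%N]|)%N.
Proof.
rewrite -sum1_card [X in (_ <= X)%N]big_mkcond /=; apply: leq_sum => j _.
rewrite inE /demand; case: (fires _ _ _ _) => //=.
by rewrite addn1.
Qed.

Lemma queue_init om : queue om 0 = 0%N.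
Proof. by rewrite /queue big1. Qed.

(** The requests of one step come from distinct cups, all with positive demand, so at least the
    minimum of [p.+1] and the load is served. *)
Lemma queue_step om s : (queue om s.+1 <= queue om s + excess om s)%N.
Proof.
have := queueS om s; have := load_le_card om s.
rewrite card_served_of /excess; lia.
Qed.

Lemma queue_drop_busy om s :
  (p < #|[pred j | (0 < demand om s j)%N]|)%N ->
  (queue om s.+1 < queue om s + excess om s)%N.
Proof.
move=> busy; have := queueS om s.
rewrite card_served_of (minn_idPl busy) /excess; lia.
Qed.

(** If at most [p] cups have demand, all are served, including [j], which added no request; so more
    requests are served than issued. *)
Lemma queue_drop_idle om s j : (0 < pend om s j)%N -> ~~ fires rate om s j ->
  (queue om s.+1 < queue om s + excess om s)%N.
Proof.
move=> pj fj.
have [/queue_drop_busy // | few] := ltnP p #|[pred j | (0 < demand om s j)%N]|.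
have lt_load : (load rate om s < #|[pred j | (0 < demand om s j)%N]|)%N.
  rewrite -sum1_card [X in (_ < X)%N]big_mkcond /= /load.
  rewrite (bigD1 j) // [X in (_ < X)%N](bigD1 j) //=.
  rewrite inE /demand (negbTE fj) addn0 pj add0n add1n ltnS.
  apply: leq_sum => k _; rewrite inE; case: (fires _ _ _ k) => //.
  by rewrite addn1.
have := queueS om s; rewrite card_served_of; lia.
Qed.

Lemma queue_steps om s k :
  (queue om (s + k) <= queue om s + \sum_(s <= i < s + k) excess om i)%N.
Proof.
elim: k => [|k IH]; first by rewrite addn0 big_geq ?addn0.
rewrite addnS big_nat_recr ?leq_addr //=.
by rewrite (leq_trans (queue_step _ _)) // addnA leq_add2r.
Qed.

Hypothesis z1 : 1 < z.
Hypothesis c01 : forall s j, 0 <= c s j <= 1.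

Lemma rate_itv s j : 0 <= rate s j <= z^-1.
Proof.
have /andP[c0 c1] := c01 s j; have z0 : 0 < z by exact: lt_trans z1.
by rewrite divr_ge0 ?(ltW z0) //= ler_pdivrMr // mulVf ?gt_eqF.
Qed.

Lemma rate01 s j : 0 <= rate s j < 1.
Proof.
have /andP[-> r1] := rate_itv s j; apply: le_lt_trans r1 _.
by rewrite invf_lt1 // (lt_trans _ z1).
Qed.

Lemma fires_sum om t k j :
  (\sum_(t <= s < t + k) fires rate om s j)%N%:R + pos (rate^~ j) (t + k)
    + (fired rate om t j)%:R =
  \sum_(t <= s < t + k) rate s j + pos (rate^~ j) t
    + (fired rate om (t + k) j)%:R :> R.
Proof.
elim: k => [|k IH]; first by rewrite addn0 !big_geq // !add0r.
rewrite addnS !big_nat_recr ?leq_addr //= -/(pos _ (t + k).+1) natrD.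
have := @fire_balance _ (rate^~ j) (t + k) (fired rate om (t + k) j)
  (om (t + k)%N j).
rewrite -/(fires rate om (t + k) j).
by move: IH; set next := next_fired _ _ _; rewrite /=; lra.
Qed.

(* A cup filled as fast as possible gets fewer than [k / z + 2] requests in [k]
   steps, so it must pause within [k] steps. *)
Lemma fires_pause om t k j : k%:R * (1 - z^-1) >= 2 ->
  (\sum_(t <= s < t + k) fires rate om s j < k)%N.
Proof.
move=> kz; rewrite -(ltr_nat R).
have H := fires_sum om t k j.
have /andP[p0 _] := pos_itv (rate01^~ j) (t + k).
have /andP[_ p1] := pos_itv (rate01^~ j) t.
have F0 : 0 <= (fired rate om t j)%:R :> R by [].
have F1 : (fired rate om (t + k) j)%:R <= 1 :> R by case: (fired _ _ _ _).
have : \sum_(t <= s < t + k) rate s j <= k%:R * z^-1.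
  rewrite mulr_natl -[X in _ *+ X](addKn t) -sumr_const_nat.
  by apply: ler_sum => s _; case/andP: (rate_itv s j).
lra.
Qed.

(** Follow one pending cup. If no step had a strict drop, the cup would stay pending and fire at
    each of the [k] steps, since a pause gives a drop by [queue_drop_idle]; this contradicts
    [fires_pause]. *)
Lemma queue_block om t k : k%:R * (1 - z^-1) >= 2 ->
  (queue om (t + k) <= (queue om t).-1 + \sum_(t <= s < t + k) excess om s)%N.
Proof.
move=> kz; have [q0|q0] := posnP (queue om t).
  by have := queue_steps om t k; rewrite q0.
suff [i ik drop] : exists2 i, (i < k)%N &
    (queue om (t + i).+1 < queue om (t + i) + excess om (t + i))%N.
  have h1 := queue_steps om t i.
  have h2 := queue_steps om (t + i).+1 (k - i.+1).
  rewrite (_ : ((t + i).+1 + (k - i.+1) = t + k)%N) in h2; last by lia.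
  rewrite (@big_cat_nat _ _ _ (t + i)) ?leq_addr //=; last by lia.
  rewrite (@big_ltn _ _ _ (t + i)) /=; last by lia.
  lia.
have [j pj] : exists j, (0 < pend om t j)%N.
  apply/existsP; apply: contraLR q0; rewrite negb_exists => /forallP q0.
  rewrite -leqNgt leqn0 sum_nat_eq0; apply/forallP => j /=.
  by rewrite -leqn0 leqNgt.
apply: contrapT => nodrop.
have all_busy i : (i <= k)%N -> (0 < pend om (t + i) j)%N /\
    (\sum_(t <= s < t + i) fires rate om s j = i)%N.
  elim: i => [_|i IH ik]; first by rewrite addn0 big_geq.
  have [pi si] := IH (ltnW ik).
  have fi : fires rate om (t + i) j.
    apply/negPn/negP => nf; apply: nodrop; exists i => //.
    exact: queue_drop_idle nf.
  split; last by rewrite addnS big_nat_recr ?leq_addr //= si fi addn1.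
  have few : (#|[pred j | (0 < demand om (t + i) j)%N]| <= p)%N.
    rewrite leqNgt; apply/negP => busy; apply: nodrop; exists i => //.
    exact: queue_drop_busy.
  have := pendS om (t + i) j; rewrite /demand fi addnS => pE; lia.
have [_ sk] := all_busy k (leqnn k).
by have := fires_pause om t j kz; rewrite sk ltnn.
Qed.

Lemma tank_ge0 om s j : 0 <= tank om s j.
Proof.
elim: s => //= s IH; have /andP[c0 _] := c01 s j.
case: ifP => _; last by rewrite subr0 addr_ge0.
by rewrite subr_ge0 ge_min lexx orbT.
Qed.

(** By [fire_balance] and [pendS] the bracket grows by the rate and loses 1 per service, just as the
    cup loses [z]. The [+ 1] keeps it nonnegative when a service empties the cup. *)
Lemma tank_le om s j :
  tank om s j <= z * (pos (rate^~ j) s - (fired rate om s j)%:R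
                      + (pend om s j)%:R + 1).
Proof.
have z0 : 0 < z by exact: lt_trans z1.
elim: s => [|s IH]; first by rewrite /= subr0 !addr0 add0r mulr1 ltW.
have fE : (fires rate om s j)%:R + pos (rate^~ j) s.+1
    + (fired rate om s j)%:R =
    rate s j + pos (rate^~ j) s + (fired rate om s.+1 j)%:R.
  exact: fire_balance.
have pE : (pend om s.+1 j)%:R + (j \in served om s)%:R =
    (pend om s j)%:R + (fires rate om s j)%:R :> R.
  by rewrite -!natrD pendS.
have cE : c s j = z * rate s j by rewrite /rate mulrC divfK ?gt_eqF.
rewrite -[tank om s.+1 j]/(tank om s j + c s j -
  (if j \in served om s then Num.min z (tank om s j + c s j) else 0)).
have key : tank om s j + c s j <= z * (pos (rate^~ j) s.+1
    - (fired rate om s.+1 j)%:R + (pend om s.+1 j)%:R + 1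
    + (j \in served om s)%:R).
  rewrite cE; apply: le_trans (lerD IH (lexx _)) _.
  rewrite -mulrDr ler_pM2l //; lra.
move: key; case: (j \in served om s) => key; last first.
  by move: key; rewrite addr0 subr0.
rewrite minEle; case: ifP => _.
  by rewrite lerBlDr -[X in _ <= _ + X]mulr1 -mulrDr.
rewrite subrr mulr_ge0 ?(ltW z0) //.
have /andP[p0 _] := pos_itv (rate01^~ j) s.+1.
have : (fired rate om s.+1 j)%:R <= 1 :> R by case: (fired _ _ _ _).
have : 0 <= (pend om s.+1 j)%:R :> R by [].
lra.
Qed.

Lemma tank_le_of_queue0 om s j : queue om s = 0%N -> tank om s j <= 2 * z.
Proof.
move=> /eqP; rewrite sum_nat_eq0 => /forallP /(_ j) /= /eqP q0.
have z0 : 0 < z by exact: lt_trans z1.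
apply: le_trans (tank_le om s j) _; rewrite q0 addr0 [2 * z]mulrC ler_pM2l //.
have /andP[_ p1] := pos_itv (rate01^~ j) s.
have : 0 <= (fired rate om s j)%:R :> R by [].
lra.
Qed.

End Queue.

(** * Probability of a nonempty queue *)

(** Walk back from [t] in blocks of [k] until the queue at a block's start is at most 1 or time 0 is
    reached. Every later block started nonempty and lost one request, so the excess had to make up
    for [m.-1] further requests. *)
Lemma queue_window (Q Z : nat -> nat) (k t v : nat) :
  (forall s, (Q s <= \sum_(0 <= i < s) Z i)%N) ->
  (forall s, (Q (s + k) <= (Q s).-1 + \sum_(s <= i < s + k) Z i)%N) ->
  (0 < k)%N -> (0 < v <= Q t)%N ->
  exists2 m, (0 < m <= t.+1)%N & (v + m.-1 <= \sum_(t - m * k <= i < t) Z i)%N.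
Proof.
move=> Q0 Qk k0; elim/ltn_ind: t v => t IH v /andP[v0 vQ].
have [tk|kt] := leqP t k.
  exists 1%N => //; rewrite mul1n addn0 (eqP tk).
  exact: leq_trans vQ (Q0 t).
have := Qk (t - k)%N; rewrite (subnK (ltnW kt)) => Qt.
have [Q1|Q1] := leqP (Q (t - k)%N) 1.
  by exists 1%N => //; rewrite mul1n; lia.
have [||m m1 mZ] := IH (t - k)%N _ (Q (t - k)%N).
- lia.
- by rewrite leqnn (ltnW Q1).
exists m.+1; first by lia.
rewrite (@big_cat_nat _ _ _ (t - k)) /=; [|by lia|by lia].
rewrite (_ : (t - m.+1 * k = t - k - m * k)%N); last by rewrite mulSn subnDA.
lia.
Qed.

Lemma geometric_tail_le (R : realFieldType) (u : R) (N : nat) : 1 < u ->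
  \sum_(1 <= m < N.+1) u ^- m <= (u - 1)^-1.
Proof.
move=> u1; have u0 : 0 < u by exact: lt_trans u1.
rewrite -[leRHS]mul1r ler_pdivlMr ?subr_gt0 //.
suff -> : (\sum_(1 <= m < N.+1) u ^- m) * (u - 1) = 1 - u ^- N.
  by rewrite gerBl invr_ge0 exprn_ge0 // ltW.
elim: N => [|N IH]; first by rewrite big_geq // mul0r expr0 invr1 subrr.
rewrite big_nat_recr //= mulrDl IH.
have -> : u ^- N = u ^- N.+1 * u.
  by rewrite exprS invfM mulrAC mulVf ?mul1r ?gt_eqF.
by ring.
Qed.

Lemma excess_ratio_sum_le (R : realFieldType) (x rho : R) (N : nat) :
  0 < x <= 1 -> 1 <= rho <= 1 + x / 3 ->
  \sum_(1 <= m < N.+1) (rho ^+ m - 1) / ((1 + x) ^+ m - 1) <=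
  9 * (rho - 1) / x ^+ 2.
Proof.
move=> /andP[x0 x1] /andP[r1 rx]; set u := 1 + x / 3.
(* [rho <= u] and [u ^ 2 <= 1 + x], so the ratio decays like [u ^- m]. *)
have u1 : 1 < u by rewrite /u; lra.
have u0 : 0 < u by lra.
have u2 : u ^+ 2 <= 1 + x by rewrite /u expr2; nra.
apply: (@le_trans _ _ (\sum_(1 <= m < N.+1) (rho - 1) / (u - 1) * u ^- m)).
  apply: ler_sum_nat => m /andP[m0 _].
  have um1 : 1 < u ^+ m by rewrite exprn_egt1 // -lt0n.
  have rm : (rho ^+ m - 1) <= (rho - 1) / (u - 1) * (u ^+ m - 1).
    rewrite !subrX1 [X in _ <= X]mulrA divfK ?subr_eq0 ?gt_eqF //.
    rewrite ler_wpM2l ?subr_ge0 //; apply: ler_sum => i _.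
    by rewrite lerXn2r ?nnegrE //; lra.
  have lm : (u ^+ m - 1) * u ^+ m <= (1 + x) ^+ m - 1.
    apply: (@le_trans _ _ ((u ^+ 2) ^+ m - 1)); last first.
      by rewrite lerB // lerXn2r ?nnegrE ?exprn_ge0 //; lra.
    by rewrite -exprM mulnC exprM expr2; nra.
  have l0 : 0 < (1 + x) ^+ m - 1.
    by apply: lt_le_trans lm; rewrite mulr_gt0; lra.
  rewrite ler_pdivrMr //; apply: le_trans rm _.
  rewrite -[leRHS]mulrA ler_wpM2l ?divr_ge0 ?subr_ge0 ?(ltW u1) //.
  by rewrite mulrC ler_pdivlMr //; lra.
(* The geometric sum gives a second factor [1 / (u - 1) = 3 / x], hence [9 / x ^+ 2]. *)
rewrite -mulr_sumr.
apply: le_trans (ler_wpM2l _ (geometric_tail_le N u1)) _.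
  by rewrite divr_ge0 ?subr_ge0 // ltW.
by rewrite /u le_eqVlt; apply/orP; left; apply/eqP; field; rewrite gt_eqF.
Qed.

Section Tail.
Variables (R : realType) (n p : nat) (z : R) (c : nat -> 'I_n -> R).
Local Notation O := {ffun 'I_n -> bool}.
Local Notation y := (rate z c).
Variables (m x : R) (k : nat).
Hypothesis z1 : 1 < z.
Hypothesis c01 : forall s j, 0 <= c s j <= 1.
Hypothesis ym : forall s, \sum_j y s j <= m.
Hypothesis x01 : 0 < x <= 1.
Hypothesis k0 : (0 < k)%N.
Hypothesis kz : 2 <= k%:R * (1 - z^-1).

Let zeta : R := expR (x * m) / (1 + x) ^+ p.

(** The exponential of a positive part is a maximum of two terms, bounded by their sum; this yields
    the affine factors of [expect_affine_load_le]. *)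
Lemma power_excess_le (om : nat -> O) s :
  (1 + x) ^+ excess p z c om s <= 1 + (1 + x) ^- p * (1 + x) ^+ load y om s.
Proof.
have /andP[x0 _] := x01; have l0 : 0 < 1 + x by lra.
rewrite /excess; have [le_lp|lt_pl] := leqP (load y om s) p.
  by rewrite (eqP le_lp) expr0 lerDl mulr_ge0 ?invr_ge0 ?exprn_ge0 // ltW.
by rewrite expfB // mulrC lerDr ler01.
Qed.

(** A pointwise Markov inequality with a union bound over window lengths [r]. Subtracting 1 from
    product and threshold matters, as the expected product is close to 1. Coefficient 0 before the
    window turns all windows into products over [i < t]. *)
Lemma queue_indicator_le (om : nat -> O) t :
  (0 < queue p z c om t)%:R <= \sum_(1 <= r < t.+2)
    ((1 + x) ^+ r - 1)^-1 * (\prod_(i < t) (1 +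
      (if (t - r * k <= i)%N then (1 + x) ^- p else 0) *
        (1 + x) ^+ load y om i) - 1) :> R.
Proof.
have /andP[x0 _] := x01; have l0 : 0 < 1 + x by lra.
have l1 r : 1 <= (1 + x) ^+ r by rewrite exprn_ege1 // lerDl ltW.
pose e r i := if (t - r * k <= i)%N then excess p z c om i else 0%N.
have prod_ge r : (1 + x) ^+ (\sum_(i < t) e r i)%N <= \prod_(i < t) (1 +
      (if (t - r * k <= i)%N then (1 + x) ^- p else 0) *
        (1 + x) ^+ load y om i).
  rewrite -prodrXr; apply: ler_prod => i _; rewrite exprn_ge0 ?(ltW l0) //= /e.
  by case: ifP => _; [exact: power_excess_le | rewrite mul0r addr0].
have term_ge0 r : 0 <= ((1 + x) ^+ r - 1)^-1 * (\prod_(i < t) (1 +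
      (if (t - r * k <= i)%N then (1 + x) ^- p else 0) *
        (1 + x) ^+ load y om i) - 1).
  rewrite mulr_ge0 ?invr_ge0 ?subr_ge0 //.
  exact: le_trans (prod_ge r).
case: (posnP (queue p z c om t)) => [_|q0]; first exact: sumr_ge0.
have [s|s||r /andP[r0 rt] rZ] := @queue_window (queue p z c om)
    (excess p z c om) k t 1 _ _ k0.
- by have := queue_steps p z c om 0 s; rewrite queue_init !add0n.
- exact: queue_block.
- exact: q0.
rewrite (@big_cat_nat _ _ _ r) //=; last by rewrite ltnW.
rewrite (@big_ltn _ _ _ r) //.
apply: le_trans (_ : _ <= ((1 + x) ^+ r - 1)^-1 * (\prod_(i < t) (1 +
      (if (t - r * k <= i)%N then (1 + x) ^- p else 0) *
        (1 + x) ^+ load y om i) - 1)) _; last first.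
  by rewrite addrCA lerDl addr_ge0 // sumr_ge0.
rewrite mulrC ler_pdivlMr; last by rewrite subr_gt0 exprn_egt1 ?ltrDl // -lt0n.
rewrite mul1r lerB //; apply: le_trans (prod_ge r).
apply: ler_weXn2l; first by rewrite lerDl ltW.
move: rZ; rewrite add1n prednK // => /leq_trans; apply.
by rewrite (big_nat_widenl _ 0) // big_mkord big_mkcond.
Qed.

Lemma expect_queue_le t :
  expect (coin_mass y) 0 t (fun h => (0 < queue p z c (path_of h) t)%N%:R) <=
  9 * ((1 + zeta) ^+ k - 1) / x ^+ 2.
Proof.
have /andP[x0 x1] := x01; have l0 : 0 < 1 + x by lra.
have y01 := rate01 z1 c01.
have mass0 := coin_mass_ge0 y01; have mass1 := coin_mass_sum y.
have zeta0 : 0 <= zeta by rewrite divr_ge0 ?expR_ge0 // exprn_ge0 // ltW.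
have rho1 : 1 <= (1 + zeta) ^+ k by rewrite exprn_ege1 // lerDl.
(* If [(1 + zeta) ^ k] is large then the bound exceeds 1. *)
have [rx|xr] := lerP ((1 + zeta) ^+ k) (1 + x / 3); last first.
  apply: (@le_trans _ _ (expect (coin_mass y) 0 t (fun=> 1))).
    by apply: le_expect => // h _; case: (_ < _)%N.
  rewrite expect_cst // ler_pdivlMr ?exprn_gt0 // mul1r expr2; nra.
have rho_itv : 1 <= (1 + zeta) ^+ k <= 1 + x / 3 by rewrite rho1.
apply: le_trans _ (excess_ratio_sum_le t.+1 x01 rho_itv).
apply: le_trans.
  apply: le_expect => // h _; exact: queue_indicator_le.
rewrite expect_sum; apply: ler_sum_nat => r /andP[r0 _].
rewrite expectZ mulrC ler_wpM2r //.
  by rewrite invr_ge0 subr_ge0 exprn_ege1 // lerDl ltW.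
rewrite expectD expect_cst // lerB //.
apply: le_trans.
  apply: (expect_affine_load_le y01 (ltW x0) ym t (a := fun=> 1)
    (b := fun i => if (t - r * k <= i)%N then (1 + x) ^- p else 0)) => // i.
  by case: ifP => // _; rewrite invr_ge0 exprn_ge0 // ltW.
rewrite (bigID (fun i : 'I_t => (t - r * k <= i)%N)) /=.
rewrite [X in _ * X]big1 ?mulr1; last first.
  by move=> i /negbTE ->; rewrite mul0r addr0.
rewrite (eq_bigr (fun=> 1 + zeta)); last by move=> i ->; rewrite mulrC.
rewrite -(big_mkord (fun i => t - r * k <= i)%N (fun=> 1 + zeta)).
rewrite -(big_nat_widenl _ 0 _ xpredT) // prodr_const_nat -exprM.
(* A window cut off at time 0 has fewer than [r * k] steps, hence an inequality. *)
by apply: ler_weXn2l; [rewrite lerDl | rewrite mulnC; lia].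
Qed.

End Tail.

(** * The emptier *)

Lemma eq_pos (R : realType) (y y' : nat -> R) s :
  (forall i, (i < s)%N -> y i = y' i) -> pos y s = pos y' s.
Proof. by elim: s => //= s IH E; rewrite IH ?E // => i /ltnW/E. Qed.

Lemma eq_cross (R : realType) (y y' : nat -> R) s :
  (forall i, (i <= s)%N -> y i = y' i) -> cross y s = cross y' s.
Proof. by move=> E; rewrite /cross E // (@eq_pos _ y y') // => i /ltnW/E. Qed.

Lemma eq_coin_mass (R : realType) (n : nat) (y y' : nat -> 'I_n -> R) s :
  (forall i, (i <= s)%N -> y i = y' i) -> coin_mass y s = coin_mass y' s.
Proof.
move=> E; apply/funext => o; apply: eq_bigr => j _.
suff -> : coin_prob (y^~ j) s = coin_prob (y'^~ j) s by [].
have Ej i : (i <= s)%N -> y i j = y' i j by move=> /E ->.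
rewrite /coin_prob (eq_cross Ej) Ej // (@eq_pos _ (y^~ j) (y'^~ j)) //.
by move=> i /ltnW/Ej.
Qed.

Lemma eq_fires (R : realType) (n : nat) (y y' : nat -> 'I_n -> R)
    (om om' : nat -> {ffun 'I_n -> bool}) s :
  (forall i, (i <= s)%N -> y i = y' i) ->
  (forall i, (i <= s)%N -> om i = om' i) ->
  fires y om s = fires y' om' s.
Proof.
move=> Ey Eo; apply/funext => j.
have Ex k : (k <= s)%N -> cross (y^~ j) k = cross (y'^~ j) k.
  by move=> ks; apply: eq_cross => i ik; rewrite Ey // (leq_trans ik).
rewrite /fires Ex // Eo //; congr (fire _ _ _).
elim: s Ey Eo Ex => //= s IH Ey Eo Ex.
rewrite Ex // Eo // IH // => i /leqW; [exact: Ey | exact: Eo | exact: Ex].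
Qed.

Lemma eq_state (R : realType) (n p : nat) (z : R) (c c' : nat -> 'I_n -> R)
    (om om' : nat -> {ffun 'I_n -> bool}) s :
  (forall i, (i < s)%N -> c i = c' i) ->
  (forall i, (i < s)%N -> om i = om' i) ->
  pend p z c om s = pend p z c' om' s /\ tank p z c om s = tank p z c' om' s.
Proof.
elim: s => [//|s IH] Ec Eo.
have [i /ltnW/Ec //|i /ltnW/Eo //|pE tE] := IH.
have fE : fires (rate z c) om s = fires (rate z c') om' s.
  by apply: eq_fires => // i /Ec; rewrite /rate => ->.
have sE : served p z c om s = served p z c' om' s.
  by rewrite /served /demand pE fE.
split; apply/funext => j.
  rewrite -[LHS]/(demand p z c om s j - (j \in served p z c om s))%N.
  by rewrite sE /demand pE fE.
by rewrite /= sE tE Ec.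
Qed.

(** Causality: together with [eq_coins] and [eq_coin_mass], this makes the emptier online. *)
Lemma eq_removal (R : realType) (n p : nat) (z : R) (c c' : nat -> 'I_n -> R)
    (om om' : nat -> {ffun 'I_n -> bool}) s :
  (forall i, (i <= s)%N -> c i = c' i) ->
  (forall i, (i <= s)%N -> om i = om' i) ->
  removal p z c om s = removal p z c' om' s.
Proof.
move=> Ec Eo.
have [i /ltnW/Ec //|i /ltnW/Eo //|pE tE] := @eq_state _ _ p z c c' om om' s.
apply/funext => j; rewrite /removal tE Ec // /served /demand pE.
rewrite (@eq_fires _ _ _ (rate z c') om om') // => i /Ec.
by rewrite /rate => ->.
Qed.

Section Emptier.
Variables (R : realType) (n p : nat) (z : R).
Local Notation O := {ffun 'I_n -> bool}.

Definition path (c : nat -> 'I_n -> R) (w : R) : nat -> O :=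
  coins [ffun=> false] (coin_mass (rate z c)) w.

Definition pours (h : seq ('I_n -> R)) (s : nat) : 'I_n -> R :=
  nth (fun=> 0) h s.

(** The run is replayed from the pours seen so far; the last of them has index [(size h).-1]. Pours
    past the end read as 0, harmless by causality. *)
Definition sampling_emptier : emptier R n R :=
  fun w h => removal p z (pours h) (path (pours h) w) (size h).-1.

Lemma sampling_emptierE c w i :
  sampling_emptier w (mkseq c i.+1) = removal p z c (path c w) i.
Proof.
rewrite /sampling_emptier size_mkseq /=.
have E s : (s <= i)%N -> pours (mkseq c i.+1) s = c s.
  by move=> si; rewrite /pours nth_mkseq.
apply: eq_removal => // s si; apply: eq_coins => k ks.
apply: eq_coin_mass => l lk.
by rewrite /rate E // (leq_trans lk) // (leq_trans ks).
Qed.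

Lemma waterE c w t : water sampling_emptier c w t = tank p z c (path c w) t.
Proof.
by elim: t => //= t IH; apply/funext => j; rewrite IH sampling_emptierE.
Qed.

(** Such an [f] factors through the first [t] coins, so [measurable_outcome] applies to any [Y]. *)
Lemma measurable_path_prefix c t (U : Type) (f : (nat -> O) -> U) (Y : set U) :
  (forall om om', (forall i, (i < t)%N -> om i = om' i) -> f om = f om') ->
  measurable [set w | Y (f (path c w))].
Proof.
move=> fE; have := @measurable_outcome R O [ffun=> false]
  (coin_mass (rate z c)) 0 t [set h | Y (f (path_of h))].
congr (measurable _); apply/seteqP; split=> w /=;
  by rewrite (fE (path c w) (path_of (outcome [ffun=> false]
    (coin_mass (rate z c)) 0 t w))) // => i it; rewrite /path_of nth_outcome.
Qed.

Lemma measurable_backlog c t (a : R) :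
  measurable [set w | a < backlog sampling_emptier c w t].
Proof.
rewrite (_ : [set _ | _] = [set w | [set r : R | a < r]
    (\big[Num.max/0]_j tank p z c (path c w) t j)]).
  apply: (@measurable_path_prefix c t R
    (fun om => \big[Num.max/0]_j tank p z c om t j)).
  by move=> om om' E; have [//|//|_ ->] := @eq_state _ _ p z c c om om' t.
by apply/funext => w; apply/propext; rewrite /backlog /= waterE.
Qed.

Lemma sampling_emptier_legal (eps delta : R) :
  1 < z <= 1 + 2 * delta ->
  @legal_emptier R n p eps delta _ (measurableTypeR R) sampling_emptier.
Proof.
move=> /andP[z1 zd] c cl i.
have c01 s j : 0 <= c s j <= 1 by case: (cl s) => + _; exact.
have z0 : 0 < z by exact: lt_trans z1.
split=> [w|j]; last first.
  move=> _ Y _; rewrite setTI.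
  rewrite (_ : _ @^-1` _ = [set w | [set r : 'I_n -> R | Y (r j)]
      (removal p z c (path c w) i)]); last first.
    by apply/funext => w; rewrite /preimage /= sampling_emptierE.
  apply: (@measurable_path_prefix c i.+1 _ (fun om => removal p z c om i)).
  by move=> om om' E; apply: eq_removal.
exists (served p z c (path c w) i).
rewrite sampling_emptierE waterE; split=> [|j|j].
- by rewrite card_served_of geq_minl.
- by move=> /negbTE jS; rewrite /removal jS.
- move=> jS; rewrite /removal jS; split.
  + rewrite le_min (ltW z0) addr_ge0 ?tank_ge0 //.
    by case/andP: (c01 i j).
  + by rewrite ge_min zd.
  + by rewrite ge_min lexx orbT.
Qed.

Lemma sampling_emptier_backlog_le (c : nat -> 'I_n -> R) (m x : R) (k t : nat) :
  1 < z -> z <= 3 / 2 -> (forall s j, 0 <= c s j <= 1) ->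
  (forall s, \sum_j c s j <= m) -> 0 < x <= 1 -> (0 < k)%N ->
  2 <= k%:R * (1 - z^-1) ->
  (@uniform01 R [set w | (3 < backlog sampling_emptier c w t)%R]
   <= (9 * ((1 + expR (x * m) / (1 + x) ^+ p) ^+ k - 1) / x ^+ 2)%:E)%E.
Proof.
move=> z1 z32 c01 cm x01 k0 kz.
have z0 : 0 < z by exact: lt_trans z1.
have ym s : \sum_j rate z c s j <= m.
  rewrite -mulr_suml ler_pdivrMr //; apply: le_trans (cm s) _.
  rewrite ler_peMr ?(ltW z1) //; apply: le_trans (cm s).
  by apply: sumr_ge0 => j _; case/andP: (c01 s j).
have queue_le := expect_queue_le p z1 c01 ym x01 k0 kz t.
have y01 := rate01 z1 c01.
pose B (h : seq O) := 3 < \big[Num.max/0]_j tank p z c (path_of h) t j.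
have -> : [set w | 3 < backlog sampling_emptier c w t] =
    [set w | B (outcome [ffun=> false] (coin_mass (rate z c)) 0 t w)].
  apply/funext => w; apply/propext; rewrite /backlog /B /= waterE.
  have [|_ ->] := @eq_state _ _ p z c c (path c w) (path_of (outcome
    [ffun=> false] (coin_mass (rate z c)) 0 t w)) t (fun _ _ => erefl) _ => //.
  by move=> i it; rewrite /path_of nth_outcome.
apply: le_trans (uniform01_outcome_le [ffun=> false] (coin_mass_ge0 y01)
  (coin_mass_sum _) t (fun h => B h : Prop)) _.
rewrite lee_fin; apply: le_trans queue_le; apply: le_expect => [|h _].
  exact: coin_mass_ge0.
(* Only an empty queue remains to be excluded: then every cup holds at most [2 * z <= 3]. *)
case: asboolP => //; rewrite /B; case: posnP => // q0.
rewrite ltNge => /negP[]; elim/big_ind: _ => //.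
- by move=> a b a3 b3; rewrite ge_max a3 b3.
- move=> j _; apply: le_trans (tank_le_of_queue0 z1 c01 _ q0) _; lra.
Qed.

End Emptier.

(** * Numerical estimates and choice of constants *)

(** From [1 + x >= expR (x - x ^+ 2)] the exponent per unit of [p] is at most
    [x - 2 * x ^+ 2 - (x - x ^+ 2) = - x ^+ 2]. *)
Lemma tilted_rate_le (R : realType) (x : R) (p : nat) : 0 <= x ->
  expR (x * ((1 - 2 * x) * p%:R)) / (1 + x) ^+ p <= expR (- (x ^+ 2 * p%:R)).
Proof.
move=> x0; have l0 : 0 < 1 + x by lra.
have inv_le : (1 + x)^-1 <= expR (- (x - x ^+ 2)).
  apply: (@le_trans _ _ (1 + - (x / (1 + x)))).
    by rewrite le_eqVlt; apply/orP; left; apply/eqP; field; rewrite gt_eqF.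
  apply: le_trans (expR_ge1Dx _) _; rewrite ler_expR lerN2 ler_pdivlMr //.
  have := exprn_ge0 3 x0; rewrite !exprS expr0; lra.
rewrite -exprVn; apply: (@le_trans _ _ (expR (x * ((1 - 2 * x) * p%:R)) *
    expR (- (x - x ^+ 2)) ^+ p)).
  by rewrite ler_wpM2l ?expR_ge0 // lerXn2r ?nnegrE ?expR_ge0 ?invr_ge0
    ?(ltW l0).
by rewrite -expRM_natr -expRD ler_expR expr2; lra.
Qed.

Lemma compound_le (R : realType) (u : R) (k : nat) : 0 <= u ->
  k%:R * u <= 1 / 2 -> (1 + u) ^+ k - 1 <= 2 * (k%:R * u).
Proof.
move=> u0 ku; have ku0 : 0 <= k%:R * u by rewrite mulr_ge0.
have : (1 + u) ^+ k <= (1 - k%:R * u)^-1.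
  apply: (@le_trans _ _ (expR (k%:R * u))).
    by rewrite expRM_natl lerXn2r ?nnegrE ?expR_ge0 ?expR_ge1Dx // addr_ge0.
  rewrite -[leLHS]invrK -expRN lef_pV2 ?posrE ?expR_gt0 //; last lra.
  exact: expR_ge1Dx.
have : (1 - k%:R * u)^-1 <= 1 + 2 * (k%:R * u).
  rewrite -div1r ler_pdivrMr; last lra.
  by nra.
lra.
Qed.

(** Square [a / 32 <= expR (a / 32)]; 1024 is the square of 32. *)
Lemma sqr_le_expR (R : realType) (a : R) : 0 <= a ->
  a ^+ 2 <= 1024 * expR (a / 16).
Proof.
move=> a0; rewrite (_ : a / 16 = a / 32 * 2%:R); last by field.
have := expR_ge1Dx (a / 32); rewrite expRM_natr; set e := expR _ => ae.
have h : a / 32 <= e by lra.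
have : (a / 32) ^+ 2 <= e ^+ 2 by rewrite lerXn2r ?nnegrE //; lra.
by rewrite expr_div_n -natrX; lra.
Qed.

Theorem theorem6p1 (R : realType) :
  exists alpha beta gamma C : R,
    [/\ 0 < alpha, 0 < beta, 0 < gamma & 0 < C] /\
    forall (n p : nat) (eps delta : R),
      (1 <= n)%N -> (1 <= p)%N ->
      p%:R `^ (- (1 / 3)) <= eps -> eps <= 1 / 2 ->
      alpha * expR (- (beta * eps ^+ 2 * p%:R)) <= delta -> delta < 1 ->
      exists (d : measure_display) (T : measurableType d)
             (P : probability T R) (e : emptier R n T),
        legal_emptier p eps delta e /\
        forall c : filler R n, legal_filler p eps c ->
        forall i : nat,
          (P [set w : T | (3 < backlog e c w i.+1)%R]
           <= (C * expR (- (gamma * eps ^+ 2 * p%:R)))%:E)%E.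
Proof.
(* With [E = eps ^+ 2 * p]: [zeta] contributes [expR (- (E / 4))], [k] costs [7 * expR (E / 8)] and
   [x ^- 2] costs [4 * 1024 * expR (E / 16)]. This leaves [1/4 - 1/8 - 1/16 = 1/16], and
   [18 * 7 * 4 = 504]. *)
exists 1, (1 / 8), (1 / 16), (504 * 1024); split; first by split; lra.
move=> n p eps delta _ p1 eps_ge eps_le delta_ge delta1.
have p0 : 0 < p%:R :> R by rewrite ltr0n.
have eps0 : 0 < eps by apply: lt_le_trans eps_ge; exact: powR_gt0.
have delta0 : 0 < delta.
  by apply: lt_le_trans delta_ge; rewrite mul1r expR_gt0.
have eps3 : 1 <= eps ^+ 3 * p%:R.
  rewrite -ler_pdivrMr // div1r.
  have -> : p%:R^-1 = (p%:R `^ (- (1 / 3))) ^+ 3 :> R.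
    rewrite -powR_mulrn ?powR_ge0 // -powRrM.
    by rewrite (_ : - (1 / 3) * 3%:R = -1) ?powR_inv1 ?ler0n //; field.
  by rewrite lerXn2r ?nnegrE ?powR_ge0 // ltW.
pose E := eps ^+ 2 * p%:R.
(* Here the lower bound on [eps] enters: [eps ^+ 3 * p >= 1] means [1 / eps <= E], so the polynomial
   loss is absorbed by an exponential in [E]. *)
have epsE : eps ^- 2 <= E ^+ 2.
  have h : eps^-1 <= E.
    rewrite -div1r ler_pdivrMr //; apply: le_trans eps3 _.
    by rewrite /E le_eqVlt; apply/orP; left; apply/eqP; ring.
  rewrite -exprVn lerXn2r ?nnegrE ?invr_ge0 ?(ltW eps0) //.
  by rewrite mulr_ge0 ?exprn_ge0 ?ltW.
have E0 : 0 <= E by rewrite mulr_ge0 ?exprn_ge0 // ltW.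
pose z := 1 + delta / 2; pose x := eps / 2.
have z1 : 1 < z by rewrite /z; lra.
have z32 : z <= 3 / 2 by rewrite /z; lra.
(* Since [z <= 3 / 2], [1 - z^-1 = delta / (2 * z)] is at least [delta / 3], so [6 / delta] steps
   suffice for [kz]. *)
pose k := (Num.truncn (6 / delta)).+1.
have d6 : 0 <= 6 / delta by rewrite divr_ge0 // ltW.
have k_ge : 6 / delta <= k%:R by rewrite ltW // truncnS_gt.
have k_le : k%:R <= 7 / delta.
  have /andP[t_le _] := truncn_itv d6.
  have : 1 <= delta^-1 by rewrite invf_ge1 // ltW.
  by rewrite /k -addn1 natrD; lra.
have kz : 2 <= k%:R * (1 - z^-1).
  have -> : 1 - z^-1 = delta / (2 * z).
    by rewrite /z; field; lra.
  rewrite mulrA ler_pdivlMr; last by rewrite mulr_gt0; lra.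
  have : 6 <= k%:R * delta by rewrite -ler_pdivrMr.
  lra.
exists _, (measurableTypeR R), (@uniform01 R), (@sampling_emptier R n p z).
split; first by apply: sampling_emptier_legal; rewrite z1 /z /=; lra.
move=> c cl i.
have c01 s j : 0 <= c s j <= 1 by case: (cl s) => + _; exact.
have cm s : \sum_j c s j <= (1 - 2 * x) * p%:R.
  by case: (cl s) => _; rewrite /x (_ : 1 - 2 * (eps / 2) = 1 - eps) //; field.
have x01 : 0 < x <= 1 by rewrite /x; lra.
have bound := @sampling_emptier_backlog_le R n p z c _ x k i.+1 z1 z32 c01 cm
  x01 isT kz.
set A := [set w | _] in bound *.
pose zeta := expR (x * ((1 - 2 * x) * p%:R)) / (1 + x) ^+ p.
have zeta0 : 0 <= zeta by rewrite divr_ge0 ?expR_ge0 // exprn_ge0; lra.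
have zeta_le : zeta <= expR (- (E / 4)).
  apply: le_trans (tilted_rate_le _ _) _; first by rewrite /x; lra.
  by rewrite ler_expR /x /E expr_div_n -natrX; lra.
(* If [k * zeta > 1 / 2] the right-hand side exceeds 1; otherwise the power is linearized by
   [compound_le]. *)
have prob_le : (@uniform01 R A <= (18 * (k%:R * zeta) / x ^+ 2)%:E)%E.
  have [ku|ku] := lerP (k%:R * zeta) (1 / 2).
    apply: le_trans bound _; rewrite lee_fin ler_wpM2r ?invr_ge0 ?exprn_ge0 //.
      lra.
    have := compound_le zeta0 ku; rewrite -/zeta; lra.
  apply: (@le_trans _ _ 1%E).
    by apply: probability_le1; exact: measurable_backlog.
  rewrite lee_fin ler_pdivlMr ?exprn_gt0 //; last lra.
  by rewrite mul1r expr2; nra.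
apply: le_trans prob_le _; rewrite lee_fin.
have delta_inv : delta^-1 <= expR (E / 8).
  rewrite -[leRHS]invrK -expRN lef_pV2 ?posrE ?expR_gt0 //.
  by apply: le_trans delta_ge; rewrite mul1r ler_expR /E; lra.
rewrite (_ : - (1 / 16 * eps ^+ 2 * p%:R) = - (E / 4) + (E / 8 + E / 16));
  last first.
  by rewrite /E; field.
rewrite !expRD.
have x_inv : (x ^+ 2)^-1 <= 4 * (1024 * expR (E / 16)).
  rewrite /x expr_div_n invfM invrK mulrC -natrX ler_wpM2l //.
  exact: le_trans epsE (sqr_le_expR E0).
apply: (@le_trans _ _ (18 * (7 * expR (E / 8) * expR (- (E / 4))) *
    (4 * (1024 * expR (E / 16))))); last by lra.
have x20 : 0 <= (x ^+ 2)^-1 by rewrite invr_ge0 exprn_ge0; lra.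
have kzeta : k%:R * zeta <= 7 * expR (E / 8) * expR (- (E / 4)).
  apply: ler_pM => //; apply: le_trans k_le _.
  by rewrite ler_wpM2l.
apply: ler_pM => //; first by rewrite mulr_ge0 // mulr_ge0.
by rewrite ler_wpM2l.
Qed.
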